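(* Every finitely presented group admitting an epimorphism onto the Basilica group $\mathfrak B$ is large (in particular contains non-abelian free subgroups).
   Context: Let $X=\{0,1\}$ and $X^*$ the binary rooted tree of finite words. The Basilica group $\mathfrak B$ is the group of automorphisms of $X^*$ generated by $a,b$ defined recursively by $a(0w)=1\,b(w)$, $a(1w)=0w$, $b(0w)=0\,a(w)$, $b(1w)=1w$ (i.e. $a=(b,1)\tau$, $b=(a,1)$ with $\tau$ the swap of the first letter). A group is large if it has a finite-index subgroup admitting an epimorphism onto a non-abelian free group. *)

(* Defs.v *)
From Stdlib Require Import List Bool FunctionalExtensionality ProofIrrelevance.
Import ListNotations.
Set Implicit Arguments.

Record group := Group {
  gcar :> Type;
  gmul : gcar -> gcar -> gcar;
  gone : gcar;
  ginv : gcar -> gcar;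
  gassoc : forall x y z, gmul x (gmul y z) = gmul (gmul x y) z;
  gidl : forall x, gmul gone x = x;
  ginvl : forall x, gmul (ginv x) x = gone }.

Arguments gmul {g}. Arguments gone {g}. Arguments ginv {g}.

Definition is_hom {G K : group} (f : G -> K) : Prop :=
  forall x y : G, f (gmul x y) = gmul (f x) (f y).

Definition is_epi {G K : group} (f : G -> K) : Prop :=
  is_hom f /\ forall k : K, exists g : G, f g = k.

Definition fword := list (nat * bool).

Definition eval_fword {G : group} (gens : nat -> G) (w : fword) : G :=
  fold_right (fun (l : nat * bool) (acc : G) => gmul (if snd l then ginv (gens (fst l)) else gens (fst l)) acc)
             gone w.

Definition fword_on (n : nat) (w : fword) : Prop := Forall (fun l => fst l < n) w.

(* The congruence on the free monoid over X^{+-1} defining <X | R>: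
   free cancellation and deletion of relators.  pres_eq R w [] means
   that w lies in the normal closure of R in the free group. *)
Inductive pres_eq (R : list fword) : fword -> fword -> Prop :=
| pe_free u v i s : pres_eq R (u ++ (i, s) :: (i, negb s) :: v) (u ++ v)
| pe_rel u r v : In r R -> pres_eq R (u ++ r ++ v) (u ++ v)
| pe_refl u : pres_eq R u u
| pe_sym u v : pres_eq R u v -> pres_eq R v u
| pe_trans u v w : pres_eq R u v -> pres_eq R v w -> pres_eq R u w.

(* G is isomorphic to <x_0,...,x_{n-1} | R> with R finite, via x_i |-> gens i
   (von Dyck: the map is onto, kills R, and its kernel is the normal closure
   of R). *)
Definition finitely_presented (G : group) : Prop :=
  exists (n : nat) (gens : nat -> G) (R : list fword),
    (forall r, In r R -> fword_on n r) /\
    (forall r, In r R -> eval_fword gens r = gone) /\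
    (forall g : G, exists w, fword_on n w /\ eval_fword gens w = g) /\
    (forall w, fword_on n w -> eval_fword gens w = gone -> pres_eq R w []).

Definition eval_kword {K : group} (w : list (K * bool)) : K :=
  fold_right (fun (l : K * bool) (acc : K) => gmul (if snd l then ginv (fst l) else fst l) acc) gone w.

Fixpoint freely_reduced {K : group} (w : list (K * bool)) : Prop :=
  match w with
  | (x, s) :: (((y, t) :: _) as w') => ~ (x = y /\ t = negb s) /\ freely_reduced w'
  | _ => True
  end.

Definition free_basis {K : group} (B : K -> Prop) : Prop :=
  (forall k : K, exists w, Forall (fun l => B (fst l)) w /\ eval_kword w = k) /\
  (forall w, w <> [] -> Forall (fun l => B (fst l)) w -> freely_reduced w ->
             eval_kword w <> gone).

Definition nonabelian_free (K : group) : Prop :=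
  exists B : K -> Prop, free_basis B /\ exists x y, B x /\ B y /\ x <> y.

Definition subgroup {G : group} (H : G -> Prop) : Prop :=
  H gone /\ (forall x y, H x -> H y -> H (gmul x y)) /\ (forall x, H x -> H (ginv x)).

Definition finite_index {G : group} (H : G -> Prop) : Prop :=
  exists reps : list G, forall x : G, exists g, In g reps /\ H (gmul (ginv g) x).

Definition large (G : group) : Prop :=
  exists H : G -> Prop, subgroup H /\ finite_index H /\
    exists (K : group) (psi : G -> K), nonabelian_free K /\
      (forall x y, H x -> H y -> psi (gmul x y) = gmul (psi x) (psi y)) /\
      (forall k : K, exists h, H h /\ psi h = k).

(* X = {0,1} encoded as false = 0, true = 1.                             *)
(* a = (b,1) tau,  b = (a,1)                                            *)
Fixpoint a_act (w : list bool) : list bool :=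
  match w with
  | [] => []
  | false :: w' => true :: b_act w'
  | true :: w' => false :: w'
  end
with b_act (w : list bool) : list bool :=
  match w with
  | [] => []
  | false :: w' => false :: a_act w'
  | true :: w' => true :: w'
  end.

Fixpoint a_inv (w : list bool) : list bool :=
  match w with
  | [] => []
  | true :: w' => false :: b_inv w'
  | false :: w' => true :: w'
  end
with b_inv (w : list bool) : list bool :=
  match w with
  | [] => []
  | false :: w' => false :: a_inv w'
  | true :: w' => true :: w'
  end.

Lemma ab_inv_all w :
  a_inv (a_act w) = w /\ b_inv (b_act w) = w /\ a_act (a_inv w) = w /\ b_act (b_inv w) = w.
Proof.
  induction w as [|c w IH]; [simpl; tauto|].
  destruct IH as (H1 & H2 & H3 & H4).
  destruct c; simpl; rewrite ?H1, ?H2, ?H3, ?H4; tauto.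
Qed.

Definition bletter (l : bool * bool) : list bool -> list bool :=
  match l with
  | (false, false) => a_act | (false, true) => a_inv
  | (true, false) => b_act | (true, true) => b_inv
  end.

Definition beval (w : list (bool * bool)) : list bool -> list bool :=
  fold_right (fun l f => fun x => bletter l (f x)) (fun x => x) w.

Definition bflip (l : bool * bool) : bool * bool := (fst l, negb (snd l)).
Definition binvword (w : list (bool * bool)) := rev (map bflip w).

Lemma beval_app u v x : beval (u ++ v) x = beval u (beval v x).
Proof. induction u as [|l u IH]; simpl; [reflexivity| now rewrite IH]. Qed.

Lemma bletter_flip l x : bletter (bflip l) (bletter l x) = x.
Proof.
  destruct l as [[|] [|]]; simpl; apply ab_inv_all.
Qed.

Lemma binv_eval w x : beval (binvword w) (beval w x) = x.
Proof.
  induction w as [|l w IH]; [reflexivity|].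
  unfold binvword in *. cbn [map rev]. rewrite beval_app.
  change (beval [bflip l] (beval (l :: w) x)) with
    (bletter (bflip l) (bletter l (beval w x))).
  rewrite bletter_flip. apply IH.
Qed.

Lemma binvword_invol w : binvword (binvword w) = w.
Proof.
  unfold binvword. rewrite map_rev, rev_involutive, map_map.
  transitivity (map (fun x => x) w); [|apply map_id].
  apply map_ext. intros [g s]. unfold bflip; simpl. now rewrite negb_involutive.
Qed.

Lemma binvword_app u v : binvword (u ++ v) = binvword v ++ binvword u.
Proof. unfold binvword. now rewrite map_app, rev_app_distr. Qed.

(* An element of the Basilica group: a tree automorphism given by a word in
   a, b, stored together with its inverse. *)
Definition bas_prop (p : (list bool -> list bool) * (list bool -> list bool)) : Prop :=
  exists w, fst p = beval w /\ snd p = beval (binvword w).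

Definition bas_car := { p | bas_prop p }.

Definition bas_fun (x : bas_car) : list bool -> list bool := fst (proj1_sig x).

Lemma bas_one_prop : bas_prop ((fun x => x), (fun x => x)).
Proof. exists []. split; reflexivity. Qed.
Definition bas_one : bas_car := exist _ _ bas_one_prop.

Lemma bas_mul_prop (x y : bas_car) :
  bas_prop ((fun v => fst (proj1_sig x) (fst (proj1_sig y) v)),
            (fun v => snd (proj1_sig y) (snd (proj1_sig x) v))).
Proof.
  destruct x as [[f fi] [u [Hf Hfi]]], y as [[g gi] [v [Hg Hgi]]]; simpl in *.
  exists (u ++ v); simpl; split; apply functional_extensionality; intro t.
  - now rewrite beval_app, Hf, Hg.
  - now rewrite binvword_app, beval_app, Hfi, Hgi.
Qed.
Definition bas_mul (x y : bas_car) : bas_car := exist _ _ (bas_mul_prop x y).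

Lemma bas_inv_prop (x : bas_car) : bas_prop (snd (proj1_sig x), fst (proj1_sig x)).
Proof.
  destruct x as [[f fi] [u [Hf Hfi]]]; simpl in *.
  exists (binvword u). rewrite binvword_invol. now split.
Qed.
Definition bas_inv (x : bas_car) : bas_car := exist _ _ (bas_inv_prop x).

Lemma bas_eq (x y : bas_car) : proj1_sig x = proj1_sig y -> x = y.
Proof.
  destruct x as [p hp], y as [q hq]; simpl; intros ->.
  f_equal; apply proof_irrelevance.
Qed.

Lemma bas_assoc x y z : bas_mul x (bas_mul y z) = bas_mul (bas_mul x y) z.
Proof. apply bas_eq; reflexivity. Qed.

Lemma bas_idl x : bas_mul bas_one x = x.
Proof. apply bas_eq; destruct x as [[f fi] h]; reflexivity. Qed.

Lemma bas_invl x : bas_mul (bas_inv x) x = bas_one.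
Proof.
  apply bas_eq. destruct x as [[f fi] [u [Hf Hfi]]]; simpl in *.
  subst f fi. f_equal; apply functional_extensionality; intro t; apply binv_eval.
Qed.

Definition Basilica : group :=
  @Group bas_car bas_mul bas_one bas_inv bas_assoc bas_idl bas_invl.

(* Main.v *)
From Stdlib Require Import List Bool Lia Classical ClassicalEpsilon ProofIrrelevance.
Require Import Defs.
Import ListNotations.

(* For the free group F on a, b, let K_n be the set of words that fix level n
   of the tree and whose 2^n sections at level n are trivial in F.  The
   basilica recursion is contracting, so the kernel of F -> B is the increasing
   union of the K_n.  A finitely presented group G mapping onto B involves only
   finitely many relations, hence already maps onto F / K_N for some N.  Taking
   the section at the vertex 0^N maps the stabilizer of 0^N onto F (the section
   of b at 0 is a, that of a^2 is b), and this map kills K_N; so the preimage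
   in G of the stabilizer maps onto F. *)

Notation letter := (bool * bool)%type.
Notation word := (list letter).

Lemma bflip_invol (l : letter) : bflip (bflip l) = l.
Proof. now destruct l as [[|] [|]]. Qed.

Lemma letter_eq_dec (l m : letter) : {l = m} + {l <> m}.
Proof. decide equality; apply bool_dec. Defined.

(** * The free group on two generators *)

(** Left multiplication by a letter on reduced words. [norm] lets a word act on the empty word,
    which yields normal forms without a confluence argument. *)
Definition push (l : letter) (w : word) : word :=
  match w with
  | m :: w' => if letter_eq_dec m (bflip l) then w' else l :: w
  | [] => [l]
  end.

Definition norm (w : word) : word := fold_right push [] w.

Fixpoint reduced (w : word) : Prop :=
  match w with
  | l :: (m :: _) as w' => m <> bflip l /\ reduced w'
  | _ => True
  end.

Lemma reduced_tail l w : reduced (l :: w) -> reduced w.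
Proof. destruct w; simpl; tauto. Qed.

Lemma reduced_push l w : reduced w -> reduced (push l w).
Proof.
  destruct w as [|m w]; [easy|]. intros Hw. unfold push.
  destruct (letter_eq_dec m (bflip l)); [now apply reduced_tail in Hw|].
  split; assumption.
Qed.

Lemma reduced_fold_push w x : reduced x -> reduced (fold_right push x w).
Proof. intros Hx. induction w; [easy|]. now apply reduced_push. Qed.

Lemma reduced_norm w : reduced (norm w).
Proof. now apply reduced_fold_push. Qed.

Lemma norm_of_reduced w : reduced w -> norm w = w.
Proof.
  induction w as [|l w IH]; [easy|]. intros Hw.
  cbn. fold (norm w). rewrite IH by now apply reduced_tail in Hw.
  destruct w as [|m w]; [easy|]. destruct Hw as [Hm _]. unfold push.
  now destruct (letter_eq_dec m (bflip l)).
Qed.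

(** Inverse letters act as inverse permutations of the reduced words: if the inner [push] cancels,
    reducedness keeps the outer one from cancelling again. *)
Lemma push_flip l w : reduced w -> push l (push (bflip l) w) = w.
Proof.
  destruct w as [|m w]; unfold push at 2.
  - intros _. unfold push. now destruct (letter_eq_dec (bflip l) (bflip l)).
  - rewrite bflip_invol. destruct (letter_eq_dec m l) as [->|Hm].
    + intros Hw. destruct w as [|k w]; [easy|]. destruct Hw as [Hk _].
      unfold push. now destruct (letter_eq_dec k (bflip l)).
    + intros _. unfold push. now destruct (letter_eq_dec (bflip l) (bflip l)).
Qed.

Lemma fold_push_push l u x :
  reduced x -> fold_right push x (push l u) = push l (fold_right push x u).
Proof.
  intros Hx. destruct u as [|m u]; [easy|]. unfold push at 2.
  destruct (letter_eq_dec m (bflip l)) as [->|_]; [|easy].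
  cbn. symmetry. apply push_flip. now apply reduced_fold_push.
Qed.

Lemma norm_app u v : norm (u ++ v) = fold_right push (norm v) u.
Proof. unfold norm. apply fold_right_app. Qed.

Lemma norm_app_norm_l u v : norm (norm u ++ v) = norm (u ++ v).
Proof.
  rewrite !norm_app. induction u as [|l u IH]; [easy|].
  cbn. fold (norm u). rewrite fold_push_push by apply reduced_norm. now rewrite IH.
Qed.

Lemma norm_idem w : norm (norm w) = norm w.
Proof. apply norm_of_reduced, reduced_norm. Qed.

Lemma norm_app_norm_r u v : norm (u ++ norm v) = norm (u ++ v).
Proof. now rewrite !norm_app, norm_idem. Qed.

Lemma norm_cancel l w : norm (l :: bflip l :: w) = norm w.
Proof. apply (push_flip l). apply reduced_norm. Qed.

Lemma norm_binvword_l w : norm (binvword w ++ w) = [].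
Proof.
  induction w as [|l w IH]; [easy|].
  change (binvword (l :: w)) with (binvword w ++ [bflip l]).
  rewrite <- app_assoc, <- norm_app_norm_r. cbn [app].
  pose proof (norm_cancel (bflip l) w) as H. rewrite bflip_invol in H.
  now rewrite H, norm_app_norm_r.
Qed.

(** Elements are normal forms, so that equality in the free group is Leibniz equality, as the record
    [group] demands. *)
Definition free_car := { w : word | norm w = w }.

Definition free_of (w : word) : free_car := exist _ (norm w) (norm_idem w).

Lemma free_of_ext u v : norm u = norm v -> free_of u = free_of v.
Proof.
  intros H. apply eq_sig_hprop; [intros; apply proof_irrelevance|exact H].
Qed.

Lemma free_of_proj (x : free_car) : free_of (proj1_sig x) = x.
Proof.
  apply eq_sig_hprop; [intros; apply proof_irrelevance|exact (proj2_sig x)].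
Qed.

Definition free_mul (x y : free_car) : free_car := free_of (proj1_sig x ++ proj1_sig y).
Definition free_inv (x : free_car) : free_car := free_of (binvword (proj1_sig x)).

Lemma free_mul_of u v : free_mul (free_of u) (free_of v) = free_of (u ++ v).
Proof. apply free_of_ext. cbn. now rewrite norm_app_norm_l, norm_app_norm_r. Qed.

Lemma free_assoc x y z : free_mul x (free_mul y z) = free_mul (free_mul x y) z.
Proof.
  rewrite <- (free_of_proj x), <- (free_of_proj y), <- (free_of_proj z).
  now rewrite !free_mul_of, app_assoc.
Qed.

Lemma free_idl x : free_mul (free_of []) x = x.
Proof. rewrite <- (free_of_proj x). now rewrite free_mul_of. Qed.

Lemma free_invl x : free_mul (free_inv x) x = free_of [].
Proof.
  unfold free_inv. rewrite <- (free_of_proj x) at 2. rewrite free_mul_of.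
  apply free_of_ext, norm_binvword_l.
Qed.

Definition Free2 : group :=
  @Group free_car free_mul (free_of []) free_inv free_assoc free_idl free_invl.

Definition free_gen (i : bool) : Free2 := free_of [(i, false)].

Definition lift_letter (l : letter) : Free2 * bool := (free_gen (fst l), snd l).

Lemma eval_lift u : eval_kword (map lift_letter u) = free_of u :> Free2.
Proof.
  induction u as [|[i s] u IH]; [easy|].
  transitivity (free_mul (free_of [(i, s)]) (free_of u)); [|apply free_mul_of].
  rewrite <- IH. destruct s; reflexivity.
Qed.

Lemma Free2_nonabelian_free : nonabelian_free Free2.
Proof.
  exists (fun k => exists i, k = free_gen i). split; [split|].
  - intros k. exists (map lift_letter (proj1_sig k)). split.
    + apply Forall_map, Forall_forall. intros [i s] _. now exists i.
    + rewrite eval_lift. apply free_of_proj.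
  - intros w Hne HB Hred.
    (* A word over the basis comes from a word in letters; reducedness carries over, and a reduced
       word is its own normal form. *)
    assert (Hu : exists u, w = map lift_letter u).
    { clear Hne Hred. induction HB as [|[k s] w [i Hi] _ [u ->]]; [now exists []|].
      exists ((i, s) :: u). cbn in Hi. now rewrite Hi. }
    destruct Hu as [u ->]. rewrite eval_lift.
    assert (Hr : reduced u).
    { clear Hne HB. induction u as [|[i s] u IH]; [easy|].
      destruct u as [|[j t] u]; [easy|]. cbn in Hred. destruct Hred as [Hij Hred].
      split; [|now apply IH]. intros [= -> ->]. now apply Hij. }
    intros E. apply (f_equal (@proj1_sig _ _)) in E. cbn in E.
    rewrite norm_of_reduced in E by assumption. now subst u.
  - exists (free_gen false), (free_gen true).
    split; [now exists false|]. split; [now exists true|].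
    intros E. apply (f_equal (@proj1_sig _ _)) in E. discriminate.
Qed.

(** * Sections of words *)

Definition lperm (l : letter) (c : bool) : bool := if fst l then c else negb c.

(* [a] has a nontrivial section at [0] only, its inverse at [1] only. *)
Definition lsec (l : letter) (c : bool) : word :=
  match l with
  | (true, s) => if c then [] else [(false, s)]
  | (false, s) => if eqb s c then [(true, s)] else []
  end.

Fixpoint wperm (w : word) (c : bool) : bool :=
  match w with [] => c | l :: w' => lperm l (wperm w' c) end.

(** The rightmost letter acts first. Sections stay unreduced, so that their lengths can be
    counted. *)
Fixpoint wsec (w : word) (c : bool) : word :=
  match w with [] => [] | l :: w' => lsec l (wperm w' c) ++ wsec w' c end.

Lemma bletter_cons l c x : bletter l (c :: x) = lperm l c :: beval (lsec l c) x.
Proof. now destruct l as [[|] [|]], c. Qed.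

Lemma beval_cons w c x : beval w (c :: x) = wperm w c :: beval (wsec w c) x.
Proof.
  induction w as [|l w IH]; [easy|].
  cbn [beval fold_right]. fold (beval w). cbn [wsec wperm].
  now rewrite IH, bletter_cons, beval_app.
Qed.

Lemma beval_nil w : beval w [] = [].
Proof.
  induction w as [|l w IH]; [easy|]. cbn. fold (beval w). rewrite IH.
  now destruct l as [[|] [|]].
Qed.

Lemma beval_length w x : length (beval w x) = length x.
Proof.
  revert w. induction x as [|c x IH]; intros w; [now rewrite beval_nil|].
  rewrite beval_cons. cbn. now rewrite IH.
Qed.

Lemma wperm_app u v c : wperm (u ++ v) c = wperm u (wperm v c).
Proof. induction u as [|l u IH]; [easy|]. cbn. now rewrite IH. Qed.

Lemma wsec_app u v c : wsec (u ++ v) c = wsec u (wperm v c) ++ wsec v c.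
Proof.
  induction u as [|l u IH]; [easy|].
  cbn. now rewrite IH, wperm_app, app_assoc.
Qed.

Lemma wperm_norm w c : wperm (norm w) c = wperm w c.
Proof.
  induction w as [|l w IH]; [easy|]. cbn. fold (norm w). rewrite <- IH.
  destruct (norm w) as [|m x]; [easy|]. unfold push.
  destruct (letter_eq_dec m (bflip l)) as [->|_]; [|easy].
  cbn. destruct l as [[|] s]; cbn; now rewrite ?negb_involutive.
Qed.

(** A cancelling pair contributes to a section either nothing or a cancelling pair, so sections are
    well defined on the free group. *)
Lemma norm_wsec_norm w c : norm (wsec (norm w) c) = norm (wsec w c).
Proof.
  induction w as [|l w IH]; [easy|]. cbn. fold (norm w).
  rewrite <- norm_app_norm_r, <- IH, norm_app_norm_r, <- wperm_norm.
  destruct (norm w) as [|m x]; [reflexivity|]. unfold push.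
  destruct (letter_eq_dec m (bflip l)) as [->|_]; [|reflexivity].
  cbn [wsec wperm]. rewrite app_assoc, <- (norm_app_norm_l (lsec _ _ ++ lsec _ _)).
  now destruct l as [[|] [|]], (wperm x c).
Qed.

(* [lvl_eq n u v] says that [u] and [v] agree modulo [K_n]. *)
Fixpoint lvl_eq (n : nat) (u v : word) : Prop :=
  match n with
  | 0 => norm u = norm v
  | S n => forall c, wperm u c = wperm v c /\ lvl_eq n (wsec u c) (wsec v c)
  end.

Lemma lvl_eq_refl n u : lvl_eq n u u.
Proof. revert u. induction n; cbn; [easy|]. split; auto. Qed.

Lemma lvl_eq_sym n u v : lvl_eq n u v -> lvl_eq n v u.
Proof.
  revert u v. induction n as [|n IH]; cbn; [easy|].
  intros u v H c. destruct (H c). split; auto.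
Qed.

Lemma lvl_eq_trans n u v w : lvl_eq n u v -> lvl_eq n v w -> lvl_eq n u w.
Proof.
  revert u v w. induction n as [|n IH]; cbn; [congruence|].
  intros u v w H H' c. destruct (H c), (H' c). split; [congruence|eauto].
Qed.

Lemma lvl_eq_app n u u' v v' :
  lvl_eq n u u' -> lvl_eq n v v' -> lvl_eq n (u ++ v) (u' ++ v').
Proof.
  revert u u' v v'. induction n as [|n IH]; cbn; intros u u' v v' Hu Hv.
  - rewrite <- norm_app_norm_l, <- norm_app_norm_r, Hu, Hv.
    now rewrite norm_app_norm_l, norm_app_norm_r.
  - intros c. rewrite !wperm_app, !wsec_app. destruct (Hv c) as [E Hvc].
    rewrite E. destruct (Hu (wperm v' c)). split; auto.
Qed.

(** The inclusion of K_n in K_(n+1). The base case says that first-level sections are well defined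
    on the free group. *)
Lemma lvl_eq_S n u v : lvl_eq n u v -> lvl_eq (S n) u v.
Proof.
  revert u v. induction n as [|n IH]; intros u v H.
  - intros c. cbn in *. split.
    + now rewrite <- wperm_norm, H, wperm_norm.
    + now rewrite <- norm_wsec_norm, H, norm_wsec_norm.
  - intros c. destruct (H c). split; auto.
Qed.

Lemma lvl_eq_le m n u v : m <= n -> lvl_eq m u v -> lvl_eq n u v.
Proof. induction 1; auto using lvl_eq_S. Qed.

Lemma lvl_eq_norm n u v : norm u = norm v -> lvl_eq n u v.
Proof. intros H. apply (@lvl_eq_le 0); [lia|exact H]. Qed.

Lemma beval_norm w x : beval (norm w) x = beval w x.
Proof.
  induction w as [|l w IH]; [easy|]. cbn. fold (norm w) (beval w). rewrite <- IH.
  destruct (norm w) as [|m y]; [easy|]. unfold push.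
  destruct (letter_eq_dec m (bflip l)) as [->|_]; [|easy].
  cbn. fold (beval y). symmetry.
  rewrite <- (bflip_invol l) at 1. apply bletter_flip.
Qed.

(** * Contraction *)

(** Each letter has a one-letter section at one of 0 and 1 and an empty section at the other; as the
    tail permutes 0 and 1, the letter is counted once. *)
Lemma wsec_length w : length (wsec w false) + length (wsec w true) = length w.
Proof.
  induction w as [|l w IH]; [easy|]. cbn. rewrite !length_app.
  assert (E : wperm w true = negb (wperm w false)).
  { clear. induction w as [|[[|] s] w IH]; cbn; rewrite ?IH; easy. }
  rewrite E. destruct l as [[|] [|]], (wperm w false); cbn; lia.
Qed.

Lemma wsec_length_le w c : length (wsec w c) <= length w.
Proof. pose proof (wsec_length w). destruct c; lia. Qed.

Definition bpow (s : bool) (k : nat) : word := repeat (true, s) k.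
Definition apow (s : bool) (k : nat) : word := repeat (false, s) k.

Lemma wperm_bpow s k c : wperm (bpow s k) c = c.
Proof. now induction k. Qed.

Lemma bpow_cons t s k :
  reduced ((true, t) :: bpow s k) -> exists s', (true, t) :: bpow s k = bpow s' (S k).
Proof.
  destruct k as [|k]; [now exists t|]. intros [H _]. exists s.
  destruct s, t; easy.
Qed.

Lemma reduced_app_l u v : reduced (u ++ v) -> reduced u.
Proof.
  induction u as [|l u IH]; [easy|]. destruct u as [|m u]; [easy|].
  intros [H H']. split; auto.
Qed.

(** Every letter must contribute at the point reached so far. At 0 the powers of [b] contribute and
    stay, and [a] contributes and leads to 1. At 1 only a^-1 contributes, leading to 0; after an [a]
    it would cancel. *)
Lemma full_section_shape w c :
  reduced w -> length (wsec w c) = length w ->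
  if c then w = [] \/
            (exists s k, w = bpow s k ++ [(false, true)]) \/
            (exists s k, w = (false, false) :: bpow s k ++ [(false, true)])
  else exists s k, w = bpow s k \/ w = (false, false) :: bpow s k.
Proof.
  induction w as [|l w IH]; intros Hr Hl.
  { destruct c; [now left|]. exists false, 0. now left. }
  assert (Hw : length (wsec w c) = length w).
  { pose proof (wsec_length_le w c). cbn in Hl. rewrite length_app in Hl.
    assert (length (lsec l (wperm w c)) <= 1) by
      (destruct l as [[|] [|]], (wperm w c); cbn; lia). lia. }
  specialize (IH (reduced_tail _ _ Hr) Hw).
  assert (Hc : lsec l (wperm w c) <> []).
  { intros E. cbn in Hl. rewrite E in Hl. cbn in Hl. lia. }
  clear Hl Hw. destruct c.
  - destruct IH as [->|[(s & k & ->)|(s & k & ->)]].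
    + destruct l as [[|] [|]]; try easy. right; left. now exists false, 0.
    + rewrite wperm_app, wperm_bpow in Hc. right.
      destruct l as [[|] t]; cbn in Hc.
      * left. destruct (bpow_cons t s k) as [s' E].
        { exact (reduced_app_l ((true, t) :: bpow s k) _ Hr). }
        exists s', (S k). now rewrite <- E.
      * right. exists s, k. now destruct t.
    + cbn in Hc. rewrite wperm_app, wperm_bpow in Hc. cbn in Hc.
      destruct l as [[|] [|]]; try easy. now destruct Hr.
  - destruct IH as (s & k & [->| ->]).
    + rewrite wperm_bpow in Hc. destruct l as [[|] t]; cbn in Hc.
      * destruct (bpow_cons t s k Hr) as [s' E]. exists s', (S k). now left.
      * exists s, k. right. now destruct t.
    + cbn in Hc. rewrite wperm_bpow in Hc.
      destruct l as [[|] [|]]; try easy. now destruct Hr.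
Qed.

(** The other shapes contain exactly one letter a^(+-1), hence swap 0 and 1. *)
Lemma full_section_fixed w c :
  reduced w -> wperm w c = c -> length (wsec w c) = length w ->
  exists s k, w = bpow s k \/ w = (false, false) :: bpow s k ++ [(false, true)].
Proof.
  intros Hr Hp Hl. pose proof (full_section_shape w c Hr Hl) as H. destruct c.
  - destruct H as [->|[(s & k & ->)|(s & k & ->)]].
    + exists false, 0. now left.
    + rewrite wperm_app, wperm_bpow in Hp. discriminate.
    + exists s, k. now right.
  - destruct H as (s & k & [->| ->]).
    + exists s, k. now left.
    + cbn in Hp. rewrite wperm_bpow in Hp. discriminate.
Qed.

Lemma wsec_bpow s k c : wsec (bpow s k) c = if c then [] else apow s k.
Proof.
  induction k as [|k IH]; [now destruct c|].
  cbn. fold (bpow s k). rewrite wperm_bpow, IH. now destruct c.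
Qed.

(** * Words acting trivially on the tree *)

Definition acts_trivially (w : word) : Prop := forall x, beval w x = x.

Lemma acts_trivially_sections w c :
  acts_trivially w -> wperm w c = c /\ acts_trivially (wsec w c).
Proof.
  intros H. split.
  - specialize (H [c]). rewrite beval_cons in H. now injection H.
  - intros x. specialize (H (c :: x)). rewrite beval_cons in H. now injection H.
Qed.

Definition lvl_trivial (w : word) : Prop := exists n, lvl_eq n w [].

Lemma lvl_trivial_sections w :
  acts_trivially w -> (forall c, lvl_trivial (wsec w c)) -> lvl_trivial w.
Proof.
  intros Ht H. destruct (H false) as [m Hm], (H true) as [n Hn].
  (* [m + n] serves both sections; passing from the sections to the word costs one level. *)
  exists (S (m + n)). intros c. split; [now apply acts_trivially_sections|].
  destruct c; [apply (lvl_eq_le n)|apply (lvl_eq_le m)]; auto; lia.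
Qed.

Lemma reduced_repeat i s k : reduced (repeat (i, s) k).
Proof.
  induction k as [|k IH]; [easy|]. destruct k; [easy|].
  split; [|exact IH]. destruct s; intros [=].
Qed.

(** A nonzero power of [a] is no power of [b], and it lacks one of the two signs that occur in a b^j
    a^-1. *)
Lemma apow_not_full s k c :
  k <> 0 -> wperm (apow s k) c = c -> length (wsec (apow s k) c) < length (apow s k).
Proof.
  intros Hk Hp. pose proof (wsec_length_le (apow s k) c).
  enough (length (wsec (apow s k) c) <> length (apow s k)) by lia. intros Hl.
  destruct (full_section_fixed (apow s k) c (reduced_repeat _ _ _) Hp Hl) as (t & j & [E|E]).
  - destruct k; [easy|]. destruct j; discriminate.
  - assert (H1 : In (false, false) (apow s k)) by (rewrite E; now left).
    assert (H2 : In (false, true) (apow s k))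
      by (rewrite E; right; apply in_or_app; right; now left).
    apply repeat_spec in H1, H2. congruence.
Qed.

(** The word b a^k b^-1 is reduced and starts with [b], so only a power of [b] could match, but it
    contains a letter a^(+-1). *)
Lemma apow_conj_not_full s k c :
  k <> 0 -> let w := (true, false) :: apow s k ++ [(true, true)] in
  wperm w c = c -> length (wsec w c) < length w.
Proof.
  intros Hk w Hp. pose proof (wsec_length_le w c).
  enough (length (wsec w c) <> length w) by lia. intros Hl.
  assert (Hr : reduced w).
  { subst w. destruct k as [|k]; [easy|]. split; [easy|]. clear.
    change (reduced (apow s (S k) ++ [(true, true)])).
    induction k as [|k IH]; [easy|]. split; [|exact IH]. destruct s; intros [=]. }
  destruct (full_section_fixed _ _ Hr Hp Hl) as (t & j & [E|E]); [|discriminate].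
  assert (H1 : In (false, s) w).
  { right. apply in_or_app. left. destruct k; [easy|now left]. }
  rewrite E in H1. apply repeat_spec in H1. discriminate.
Qed.

(* Sections of a reduced word do not get longer; a section keeps its length only
   for [b^k] and [a b^k a^-1], and then it gets shorter one level below. *)
Lemma acts_trivially_lvl_trivial w : acts_trivially w -> lvl_trivial w.
Proof.
  remember (length w) as len eqn:Hlen. revert w Hlen.
  induction len as [len IH] using Wf_nat.lt_wf_ind. intros w -> Ht.
  assert (IH' : forall u, length u < length w -> acts_trivially u -> lvl_trivial u)
    by eauto.
  clear IH.
  (* Equal length is allowed so that this applies both to [w] and to a section as long as [w]; the
     induction hypothesis is used one level below [u]. *)
  assert (shorter : forall u, length u <= length w -> acts_trivially u ->
            (forall c, wperm u c = c -> length (wsec u c) < length u) -> lvl_trivial u).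
  { intros u Hu Hut Hs. apply lvl_trivial_sections; [easy|]. intros c.
    destruct (acts_trivially_sections u c Hut) as [Hp Hc].
    apply IH'; [|easy]. specialize (Hs c Hp). lia. }
  destruct (classic (reduced w)) as [Hr|Hr].
  (* A word that is not reduced acts like its strictly shorter normal form. *)
  2:{ assert (Hn : length (norm w) < length w).
      { clear - Hr. assert (L : forall v, length (norm v) <= length v).
        { induction v as [|l v IHv]; [easy|]. cbn. fold (norm v).
          destruct (norm v) as [|m x]; cbn in *; [lia|].
          destruct (letter_eq_dec m (bflip l)); cbn; lia. }
        induction w as [|l w IHw]; [now destruct Hr|].
        cbn. fold (norm w). specialize (L w).
        destruct (classic (reduced w)) as [Hw|Hw].
        - rewrite (norm_of_reduced w Hw). destruct w as [|m w]; [now destruct Hr|].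
          unfold push. destruct (letter_eq_dec m (bflip l)); [cbn; lia|].
          now destruct Hr.
        - specialize (IHw Hw). destruct (norm w) as [|m x]; cbn in *; [lia|].
          destruct (letter_eq_dec m (bflip l)); cbn; lia. }
      destruct (IH' (norm w) Hn) as [n H].
      { intros x. rewrite beval_norm. apply Ht. }
      exists n. apply (lvl_eq_trans n w (norm w)); [|easy].
      apply lvl_eq_norm. now rewrite norm_idem. }
  destruct (classic (exists c, length (wsec w c) = length w)) as [[c Hl]|Hnl].
  2:{ apply shorter; [lia|easy|]. intros c _. pose proof (wsec_length_le w c).
      enough (length (wsec w c) <> length w) by lia. eauto. }
  apply lvl_trivial_sections; [easy|]. intros d.
  destruct (acts_trivially_sections w c Ht) as [Hp _].
  destruct (acts_trivially_sections w d Ht) as [_ Hd].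
  pose proof (wsec_length_le w d) as Hle.
  assert (Hnil : lvl_trivial []) by now exists 0.
  destruct (full_section_fixed w c Hr Hp Hl) as (s & k & [E|E]).
  (* For w = b^k the section at 1 is empty and the one at 0 is a^k. *)
  - rewrite E in *. rewrite wsec_bpow in *. destruct d; [easy|].
    destruct k as [|k]; [easy|]. apply shorter; [easy|easy|].
    intros d. now apply apow_not_full.
  (* For w = a b^k a^-1, reducedness gives k > 0; the section at 0 is empty and the one at 1 is b
     a^k b^-1. *)
  - destruct k as [|k]; [subst w; now destruct Hr|].
    assert (Ed : wsec w d = if d then (true, false) :: apow s (S k) ++ [(true, true)] else []).
    { rewrite E. cbn [wsec]. rewrite wsec_app, wperm_app, !wperm_bpow, wsec_bpow.
      now destruct d. }
    rewrite Ed in *. destruct d; [|easy]. apply shorter; [easy|easy|].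
    intros d. now apply apow_conj_not_full.
Qed.

(** The kernel of F -> B is the union of the K_n: v^-1 u acts trivially, hence lies in some K_n, and
    multiplying by [v] recovers [u]. *)
Lemma beval_eq_lvl_eq u v : (forall x, beval u x = beval v x) -> exists n, lvl_eq n u v.
Proof.
  intros H. destruct (acts_trivially_lvl_trivial (binvword v ++ u)) as [n Hn].
  { intros x. now rewrite beval_app, H, binv_eval. }
  assert (Hv : norm (v ++ binvword v) = []).
  { rewrite <- (binvword_invol v) at 1. apply norm_binvword_l. }
  exists n. apply (lvl_eq_trans n u ((v ++ binvword v) ++ u)).
  - apply lvl_eq_norm. now rewrite <- norm_app_norm_l, Hv.
  - rewrite <- app_assoc. rewrite <- (app_nil_r v) at 3.
    apply lvl_eq_app; [apply lvl_eq_refl|easy].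
Qed.

(** * The section at the vertex 0^n *)

Fixpoint vsec (n : nat) (w : word) : word :=
  match n with 0 => w | S n => vsec n (wsec w false) end.

Definition vertex0 (n : nat) : list bool := repeat false n.

(** The left factor is sectioned at the image of 0^n under [v], which is 0^n again. *)
Lemma vsec_app n u v :
  beval v (vertex0 n) = vertex0 n -> vsec n (u ++ v) = vsec n u ++ vsec n v.
Proof.
  revert u v. induction n as [|n IH]; intros u v; [easy|].
  cbn [vertex0 repeat]. rewrite beval_cons. intros [= Hp Hv].
  cbn [vsec]. rewrite wsec_app, Hp. now apply IH.
Qed.

(** The section at 0^n is one of the 2^n that [lvl_eq] compares, so it descends to F / K_n. *)
Lemma norm_vsec n u v : lvl_eq n u v -> norm (vsec n u) = norm (vsec n v).
Proof.
  revert u v. induction n as [|n IH]; [easy|].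
  intros u v H. destruct (H false). now apply IH.
Qed.

(** The substitution a -> b, b -> a^2, a right inverse of the section at 0. *)
Definition unsec (w : word) : word :=
  flat_map (fun l : letter => let (i, s) := l in
              if i then [(false, s); (false, s)] else [(true, s)]) w.

Lemma wperm_unsec w : wperm (unsec w) false = false.
Proof.
  induction w as [|[[|] s] w IH]; cbn; [easy| |]; fold (unsec w); now rewrite IH.
Qed.

Lemma wsec_unsec w : wsec (unsec w) false = w.
Proof.
  induction w as [|[[|] s] w IH]; cbn; [easy| |]; fold (unsec w);
    rewrite wperm_unsec, IH; cbn; [|easy]. now destruct s.
Qed.

Lemma vsec_surjective n t : exists u, beval u (vertex0 n) = vertex0 n /\ vsec n u = t.
Proof.
  induction n as [|n [u [H E]]].
  - exists t. split; [apply beval_nil|easy].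
  - exists (unsec u). cbn [vertex0 repeat vsec].
    rewrite beval_cons, wperm_unsec, wsec_unsec. split; [|easy].
    now f_equal.
Qed.

(** * Groups *)

Section GroupFacts.
Context {G : group}.
Implicit Types x y z : G.

Lemma mul_cancel_l x y z : gmul x y = gmul x z -> y = z.
Proof.
  intros H. rewrite <- (gidl G y), <- (gidl G z), <- (ginvl G x).
  now rewrite <- !gassoc, H.
Qed.

Lemma mul_one_r x : gmul x gone = x.
Proof.
  apply (mul_cancel_l (ginv x)). rewrite gassoc, ginvl. apply gidl.
Qed.

Lemma mul_inv_r x : gmul x (ginv x) = gone.
Proof.
  apply (mul_cancel_l (ginv x)). now rewrite gassoc, ginvl, gidl, mul_one_r.
Qed.

Lemma eval_fword_app (gens : nat -> G) u v :
  eval_fword gens (u ++ v) = gmul (eval_fword gens u) (eval_fword gens v).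
Proof.
  induction u as [|l u IH]; cbn; [now rewrite gidl|].
  fold (eval_fword gens (u ++ v)) (eval_fword gens u). now rewrite IH, gassoc.
Qed.

End GroupFacts.

Section Homs.
Context {G K : group} (f : G -> K).
Hypothesis f_hom : is_hom f.

Lemma hom_one : f gone = gone.
Proof.
  apply (mul_cancel_l (f gone)). rewrite <- f_hom, gidl. symmetry. apply mul_one_r.
Qed.

Lemma hom_inv x : f (ginv x) = ginv (f x).
Proof.
  apply (mul_cancel_l (f x)). now rewrite <- f_hom, !mul_inv_r, hom_one.
Qed.

End Homs.

(** One representative is kept for each value of [L] that is attained; a finite orbit thus yields
    finitely many coset representatives. *)
Lemma finite_transversal {A B : Type} (val : A -> B) (L : list B) :
  exists reps, forall x, In (val x) L -> exists g, In g reps /\ val g = val x.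
Proof.
  induction L as [|b L [reps H]]; [now exists []|].
  destruct (classic (exists g, val g = b)) as [[g Hg]|Hn].
  - exists (g :: reps). intros x [E|Hx].
    + exists g. split; [now left|congruence].
    + destruct (H x Hx) as (h & Hh & E). exists h. split; [now right|easy].
  - exists reps. intros x [E|Hx]; [|auto]. destruct Hn. now exists x.
Qed.

Lemma bool_lists_finite n : exists L, forall x : list bool, length x = n -> In x L.
Proof.
  induction n as [|n [L H]].
  - exists [[]]. intros [|]; [now left|easy].
  - exists (map (cons true) L ++ map (cons false) L). intros [|c x] Hx; [easy|].
    injection Hx as Hx. apply in_or_app.
    destruct c; [left|right]; now apply in_map, H.
Qed.

(** * Substitution of basilica words for the generators *)

Section Substitution.
Variable v : nat -> word.

Definition subst_letter (l : nat * bool) : word :=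
  if snd l then binvword (v (fst l)) else v (fst l).

Definition subst (w : fword) : word := flat_map subst_letter w.

Lemma norm_subst_letter_cancel i s :
  norm (subst_letter (i, s) ++ subst_letter (i, negb s)) = [].
Proof.
  unfold subst_letter. destruct s; cbn; [apply norm_binvword_l|].
  rewrite <- (binvword_invol (v i)) at 1. apply norm_binvword_l.
Qed.

(** Von Dyck's argument: once the relators land in K_n, the substitution respects the presentation
    modulo K_n. *)
Lemma lvl_eq_pres n R w w' :
  (forall r, In r R -> lvl_eq n (subst r) []) ->
  pres_eq R w w' -> lvl_eq n (subst w) (subst w').
Proof.
  intros HR. induction 1.
  - change ((i, s) :: (i, negb s) :: v0) with ([(i, s); (i, negb s)] ++ v0).
    unfold subst. rewrite !flat_map_app.
    apply lvl_eq_app; [apply lvl_eq_refl|].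
    change (flat_map subst_letter v0) with ([] ++ flat_map subst_letter v0) at 2.
    apply lvl_eq_app; [|apply lvl_eq_refl].
    apply lvl_eq_norm. cbn [flat_map]. rewrite app_nil_r.
    apply norm_subst_letter_cancel.
  - unfold subst. rewrite !flat_map_app.
    apply lvl_eq_app; [apply lvl_eq_refl|].
    change (flat_map subst_letter v0) with ([] ++ flat_map subst_letter v0) at 2.
    apply lvl_eq_app; [now apply HR|apply lvl_eq_refl].
  - apply lvl_eq_refl.
  - now apply lvl_eq_sym.
  - eapply lvl_eq_trans; eauto.
Qed.

End Substitution.

(** Finitely many levels have a common bound, and the K_n increase. *)
Lemma uniform_level {A : Type} (L : list A) (u v : A -> word) :
  (forall x, In x L -> exists n, lvl_eq n (u x) (v x)) ->
  exists n, forall x, In x L -> lvl_eq n (u x) (v x).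
Proof.
  induction L as [|y L IH]; intros H; [now exists 0|].
  destruct (H y (or_introl eq_refl)) as [m Hm].
  destruct IH as [n Hn]; [intros; apply H; now right|].
  exists (m + n). intros x [<-|Hx].
  - apply (lvl_eq_le m); [lia|easy].
  - apply (lvl_eq_le n); [lia|auto].
Qed.

Lemma bas_fun_word (x : Basilica) :
  exists w, bas_fun x = beval w /\ bas_fun (ginv x) = beval (binvword w).
Proof. destruct x as [[p q] [w [Hp Hq]]]. now exists w. Qed.

Lemma bas_fun_mul (x y : Basilica) t : bas_fun (gmul x y) t = bas_fun x (bas_fun y t).
Proof. reflexivity. Qed.

Lemma bas_fun_inv (x : Basilica) t : bas_fun (ginv x) (bas_fun x t) = t.
Proof. now rewrite <- bas_fun_mul, ginvl. Qed.

Lemma basilica_word (w : word) : exists x : Basilica, bas_fun x = beval w.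
Proof.
  assert (H : bas_prop (beval w, beval (binvword w))) by now exists w.
  now exists (exist _ _ H).
Qed.

(** * Mapping the stabilizer of a vertex onto the free group *)

Theorem theorem1p8 (G : group) :
  finitely_presented G ->
  (exists f : G -> Basilica, is_epi f) ->
  large G.
Proof.
  intros (n & gens & R & HRon & HR1 & Hgen & Hpres) [f [fhom fsurj]].
  destruct (choice (fun i w => bas_fun (f (gens i)) = beval w /\
                               bas_fun (ginv (f (gens i))) = beval (binvword w))
              (fun i => bas_fun_word (f (gens i)))) as [v Hv].
  set (th := subst v).
  assert (Hth : forall w t, bas_fun (f (eval_fword gens w)) t = beval (th w) t).
  { induction w as [|[i s] w IH]; intros t.
    - cbn. now rewrite (hom_one f fhom).
    - cbn. fold (eval_fword gens w) (th w). rewrite fhom, bas_fun_mul, IH, beval_app.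
      destruct (Hv i) as [H1 H2]. unfold subst_letter.
      destruct s; cbn; [rewrite (hom_inv f fhom), H2|rewrite H1]; reflexivity. }
  destruct (choice (fun g w => fword_on n w /\ eval_fword gens w = g) Hgen) as [wd Hwd].
  (* Preimages in [G] of the letters a^(+-1), b^(+-1), needed for surjectivity. *)
  assert (Hlet : forall l, exists g, forall t, bas_fun (f g) t = beval [l] t).
  { intros l. destruct (basilica_word [l]) as [x Hx]. destruct (fsurj x) as [g <-].
    exists g. intros t. now rewrite Hx. }
  destruct (choice _ Hlet) as [gl Hgl].
  destruct (uniform_level R th (fun _ => [])) as [N1 HN1].
  { intros r Hr. apply beval_eq_lvl_eq. intros t. rewrite <- Hth, HR1 by assumption.
    now rewrite (hom_one f fhom). }
  (* The chosen preimages match the letters only in B; from level [N2] on they match them in F / K_N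
     as well, so [G] maps onto F / K_N. *)
  destruct (uniform_level [(true,true); (true,false); (false,true); (false,false)]
              (fun l => th (wd (gl l))) (fun l => [l])) as [N2 HN2].
  { intros l _. apply beval_eq_lvl_eq. intros t.
    destruct (Hwd (gl l)) as [_ E]. now rewrite <- Hth, E. }
  set (N := N1 + N2).
  assert (HR : forall r, In r R -> lvl_eq N (th r) []).
  { intros r Hr. apply (lvl_eq_le N1); [lia|auto]. }
  assert (HL : forall l, lvl_eq N (th (wd (gl l))) [l]).
  { intros l. apply (lvl_eq_le N2); [lia|]. apply (HN2 l).
    destruct l as [[|] [|]]; cbn; tauto. }
  assert (th_app : forall u w, th (u ++ w) = th u ++ th w).
  { intros. apply flat_map_app. }
  assert (Htriv : forall u, fword_on n u -> eval_fword gens u = gone -> lvl_eq N (th u) []).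
  { intros u Hu E. apply (lvl_eq_pres v N R u []); auto. }
  (* The map G -> F / K_N is well defined: [u] is compared with u w^-1 w, where w^-1 is represented
     by the chosen word [w']. *)
  assert (Hwell : forall u w, fword_on n u -> fword_on n w ->
            eval_fword gens u = eval_fword gens w -> lvl_eq N (th u) (th w)).
  { intros u w Hu Hw E. destruct (Hwd (ginv (eval_fword gens w))) as [Ho Ei].
    set (w' := wd _) in *.
    apply (lvl_eq_trans N _ (th u ++ th (w' ++ w))).
    - rewrite <- (app_nil_r (th u)) at 1. apply lvl_eq_app; [apply lvl_eq_refl|].
      apply lvl_eq_sym, Htriv; [now apply Forall_app|].
      now rewrite eval_fword_app, Ei, ginvl.
    - rewrite th_app, app_assoc, <- th_app.
      change (th w) with ([] ++ th w) at 2. apply lvl_eq_app; [|apply lvl_eq_refl].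
      apply Htriv; [now apply Forall_app|].
      now rewrite eval_fword_app, Ei, E, mul_inv_r. }
  assert (Hact : forall g t, bas_fun (f g) t = beval (th (wd g)) t).
  { intros g t. rewrite <- Hth. now destruct (Hwd g) as [_ ->]. }
  exists (fun g => bas_fun (f g) (vertex0 N) = vertex0 N). split; [|split].
  - split; [now rewrite (hom_one f fhom)|]. split.
    + intros x y Hx Hy. now rewrite fhom, bas_fun_mul, Hy.
    + intros x Hx. rewrite (hom_inv f fhom). rewrite <- Hx at 1. apply bas_fun_inv.
  (* Cosets of the stabilizer correspond to points of the orbit of 0^N, which lies in the finite
     level [N]. *)
  - destruct (bool_lists_finite N) as [L HLs].
    destruct (finite_transversal (fun g => bas_fun (f g) (vertex0 N)) L) as [reps Hreps].
    exists reps. intros x. destruct (Hreps x) as (g & Hg & E).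
    + apply HLs. rewrite Hact, beval_length. apply repeat_length.
    + exists g. split; [easy|]. rewrite fhom, bas_fun_mul, (hom_inv f fhom), <- E.
      apply bas_fun_inv.
  - exists Free2, (fun g => free_of (vsec N (th (wd g)))).
    split; [exact Free2_nonabelian_free|]. split.
    + intros x y Hx Hy.
      transitivity (free_of (vsec N (th (wd x)) ++ vsec N (th (wd y))));
        [|symmetry; apply free_mul_of].
      apply free_of_ext. rewrite <- vsec_app by now rewrite <- Hact.
      apply norm_vsec. rewrite <- th_app.
      destruct (Hwd x) as [Ox Ex], (Hwd y) as [Oy Ey], (Hwd (gmul x y)) as [Oxy Exy].
      apply Hwell; [easy|now apply Forall_app|].
      now rewrite eval_fword_app, Ex, Ey, Exy.
    (* [W] replaces each letter of [u] by a generator word of its preimage, so it agrees with [u]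
       modulo K_N. *)
    + intros k. destruct (vsec_surjective N (proj1_sig k)) as (u & Hu & Ek).
      set (W := flat_map (fun l => wd (gl l)) u).
      assert (HW : fword_on n W).
      { unfold W. clear - Hwd. induction u as [|l u IH]; [constructor|].
        apply Forall_app. split; [apply Hwd|exact IH]. }
      assert (HWu : lvl_eq N (th W) u).
      { unfold W. clear - HL th_app. induction u as [|l u IH]; [apply lvl_eq_refl|].
        cbn [flat_map]. rewrite th_app.
        change (l :: u) with ([l] ++ u). now apply lvl_eq_app. }
      exists (eval_fword gens W). split.
      * rewrite Hth. rewrite <- Hu at 2. clear - Hgl Hact.
        unfold W. generalize (vertex0 N) as t.
        induction u as [|l u IH]; intros t; [easy|].
        cbn [flat_map]. unfold th, subst. rewrite flat_map_app, beval_app.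
        fold (subst v) th. change (l :: u) with ([l] ++ u).
        rewrite beval_app, <- IH. unfold th, subst in *. now rewrite <- Hact, Hgl.
      (* The map is computed from the word chosen for the value of [W], not from [W] itself; [Hwell]
         identifies the two modulo K_N. *)
      * rewrite <- (free_of_proj k), <- Ek. apply free_of_ext, norm_vsec.
        apply (lvl_eq_trans N _ (th W)); [|easy].
        destruct (Hwd (eval_fword gens W)) as [O E]. now apply Hwell.
Qed.
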